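(* Let $\mu$ be a probability measure on $\mathbb{R}$ with finite moments, $d\mu(x)=w(x)\,dx+d\mu_{\mathrm{sing}}(x)$. Let $x^* \in \mathrm{supp}(\mu)$ be such that: (i) the point $x^*$ is a Lebesgue point of $\mu$ in the sense that $w(x^* )>0$, $$\lim_{\varepsilon \rightarrow 0^+}\frac{\mu_{\mathrm{sing}} \left(x^*-\varepsilon,x^*+ \varepsilon \right)}{2 \varepsilon}=0, \qquad\text{and}\qquad \lim_{\varepsilon \rightarrow 0^+}\frac{1}{2\varepsilon}\int_{x^*-\varepsilon}^{x^*+\varepsilon} \left|w(x)-w(x^* )\right|dx=0;$$ (ii) uniformly for $a,b$ in compact sets in $\mathbb{R}$, $$\frac{K_n \left(x^*+\frac{a}{\widetilde{K}_n(x^*,x^* )},x^*+\frac{b}{\widetilde{K}_n(x^*,x^* )}\right)}{K_n(x^*,x^* )} \rightarrow \frac{\sin \pi\left(b-a \right)}{\pi \left(b-a \right)}\quad\text{as } n \rightarrow \infty.$$ Then $\mu$ satisfies the Nevai condition at $x^*$.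
   Context: $\mu$ has infinite support; $w$ is (a fixed version of) the density of its absolutely continuous part and $\mu_{\mathrm{sing}}$ its singular part with respect to Lebesgue measure. $K_n(x,y)=\sum_{j=0}^{n-1}p_j(x)p_j(y)$ is the Christoffel-Darboux kernel, where $p_j$ are the orthonormal polynomials of $\mu$, and $\widetilde K_n(x,y)=w(x)^{1/2}w(y)^{1/2}K_n(x,y)$. The function $\sin(\pi u)/(\pi u)$ is taken to be $1$ at $u=0$. Nevai condition at $x$: for any continuous compactly supported $f:\mathbb{R}\to\mathbb{R}$, $$\int (f(y)-f(x))\frac{K_n(x,y)^2}{K_n(x,x)}\,d\mu(y)\to0\quad\text{as }n\to\infty.$$ *)

(* Defs.v *)
From HB Require Import structures.
From mathcomp Require Import all_boot all_order all_algebra.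
From mathcomp Require Import all_classical all_reals all_analysis.

Set Implicit Arguments.
Unset Strict Implicit.
Unset Printing Implicit Defensive.

Import Order.TTheory GRing.Theory Num.Theory.
Import numFieldTopology.Exports numFieldNormedType.Exports.

Local Open Scope classical_set_scope.
Local Open Scope ring_scope.

Definition supp {R : realType}
    (mu : {measure set (measurableTypeR R) -> \bar R}) : set R :=
  [set x | forall U : set R, open_nbhs x U -> (0 < mu U)%E].

Definition finite_moments {R : realType}
    (mu : {measure set (measurableTypeR R) -> \bar R}) : Prop :=
  forall k : nat, mu.-integrable setT (fun x : R => (x ^+ k)%:E).

Definition mutually_singular {d : measure_display} {T : measurableType d}
    {R : realType} (m1 m2 : {measure set T -> \bar R}) : Prop :=
  exists N : set T, [/\ measurable N, m1 N = 0%E & m2 (~` N) = 0%E].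

(* d mu = w dx + d mu_sing; the everywhere defined function [w] is the chosen
   version of the density of the absolutely continuous part. *)
Definition lebesgue_decomposition {R : realType}
    (mu : {measure set (measurableTypeR R) -> \bar R}) (w : R -> R)
    (mu_sing : {measure set (measurableTypeR R) -> \bar R}) : Prop :=
  [/\ measurable_fun setT (w : measurableTypeR R -> measurableTypeR R),
      forall x, 0 <= w x,
      mutually_singular (@lebesgue_measure R) mu_sing &
      forall A : set (measurableTypeR R), measurable A ->
        mu A = (\int[@lebesgue_measure R]_(x in A) (w x)%:E + mu_sing A)%E].

(* When [mu] has finite moments and infinite support, exactly one sequence
   satisfies this predicate. *)
Definition orthonormal_polynomials {R : realType}
    (mu : {measure set (measurableTypeR R) -> \bar R})
    (p : nat -> {poly R}) : Prop :=
  [/\ forall n, size (p n) = n.+1,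
      forall n, 0 < lead_coef (p n) &
      forall i j, (\int[mu]_x ((p i).[x] * (p j).[x])%:E = (i == j)%:R%:E)%E].

Definition CD_kernel {R : realType} (p : nat -> {poly R}) (n : nat)
    (x y : R) : R :=
  \sum_(j < n) (p j).[x] * (p j).[y].

Definition weighted_CD_kernel {R : realType} (w : R -> R)
    (p : nat -> {poly R}) (n : nat) (x y : R) : R :=
  Num.sqrt (w x) * Num.sqrt (w y) * CD_kernel p n x y.

Definition sine_kernel {R : realType} (u : R) : R :=
  if u == 0 then 1 else sin (pi * u) / (pi * u).

Definition lebesgue_point {R : realType} (w : R -> R)
    (mu_sing : {measure set (measurableTypeR R) -> \bar R}) (x0 : R) : Prop :=
  [/\ 0 < w x0,
      (((2 * e)^-1)%R%:E * mu_sing `]x0 - e, x0 + e[%classic%R)%E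
        @[e --> (0 : R)^'+] --> 0%E &
      (((2 * e)^-1)%R%:E *
        \int[@lebesgue_measure R]_(x in `]x0 - e, x0 + e[%classic%R)
          `|(w x - w x0)%R|%:E)%E
        @[e --> (0 : R)^'+] --> 0%E].

(* At [n = 0] the kernel vanishes and division by 0 returns 0; this does not
   affect the limit. *)
Definition bulk_universality {R : realType} (w : R -> R)
    (p : nat -> {poly R}) (x0 : R) : Prop :=
  forall A B : set R, compact A -> compact B ->
    {uniform A `*` B,
      (fun (n : nat) (ab : R * R) =>
        CD_kernel p n (x0 + ab.1 / weighted_CD_kernel w p n x0 x0)
                      (x0 + ab.2 / weighted_CD_kernel w p n x0 x0)
        / CD_kernel p n x0 x0) @ \oo
      --> (fun ab : R * R => sine_kernel (ab.2 - ab.1))}.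

Definition nevai_condition {R : realType}
    (mu : {measure set (measurableTypeR R) -> \bar R})
    (p : nat -> {poly R}) (x : R) : Prop :=
  forall f : R -> R, continuous f -> compact (closure [set y | f y != 0]) ->
    (\int[mu]_y
       ((f y - f x) * (CD_kernel p n x y ^+ 2 / CD_kernel p n x x))%:E)%E
      @[n --> \oo] --> 0%E.

(* Main.v *)
Require Import Defs.
From HB Require Import structures.
From mathcomp Require Import all_boot all_order all_algebra.
From mathcomp Require Import all_classical all_reals all_analysis.
From mathcomp Require Import measurable_realfun ring lra.
Import Order.TTheory GRing.Theory Num.Theory.
Import numFieldTopology.Exports numFieldNormedType.Exports.
Local Open Scope classical_set_scope.
Local Open Scope ring_scope.

Set Implicit Arguments.
Unset Strict Implicit.
Unset Printing Implicit Defensive.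

(** The measures [K_n(x,y)^2 / K_n(x,x) dmu(y)] have mass one by the reproducing
    property, so it suffices that their mass near [x] tends to one.  On
    the scale [y = x + a / (w(x) K_n(x,x))], universality and the Lebesgue point
    property compare that mass on [|a| < M] with the integral of
    [(sin(pi a) / (pi a))^2], which tends to one as [M] grows.  This integral
    enters only through Riemann sums: grouping the nodes by residue modulo 1
    reduces them to a finite form of [sum_k 1/(t+k)^2 = pi^2 / sin^2(pi t)], which
    follows from the duplication formula for the sine.  That [K_n(x,x)] is
    unbounded also follows from universality: otherwise [K_n(x+s,x+s)] would be
    at most twice a fixed constant for each [s] and large [n], although it
    dominates [p_1(x+s)^2]. *)

(** * Cosecant sums and the squared sine kernel on unit-spaced nodes *)

(** The difference of the two sides vanishes at 0 and has derivative [z * sin z], nonnegative up to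
    [pi]. *)
Lemma mulr_cos_le_sin (R : realType) (y : R) :
  0 <= y <= pi / 2 -> y * cos y <= sin y.
Proof.
move=> /andP[y0 yp]; rewrite -subr_ge0.
pose f (z : R) := sin z - z * cos z.
have df (z : R) : is_derive z (1:R) f (z * sin z).
  apply: is_derive_eq.
  rewrite /GRing.scale/=; ring.
rewrite -/(f y).
have f0 : f 0 = 0 by rewrite /f sin0 mul0r subr0.
rewrite -f0.
apply: (@ger0_derive1_le_cc R f 0 (pi / 2)) => //.
- move=> x; rewrite in_itv/= => /andP[x0 xp].
  rewrite derive1E (@derive_val _ _ _ _ _ _ _ (df x)) mulr_ge0 ?(ltW x0)//.
  by rewrite sin_ge0_pi// (ltW x0)/=; have := pi_gt0 R; lra.
- apply: continuous_subspaceT => x.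
  by apply: differentiable_continuous; apply/derivable1_diffP; case: (df x).
- by rewrite in_itv/= lexx divr_ge0// pi_ge0.
- by rewrite in_itv/= y0 yp.
Qed.

(** Squaring [y * cos y <= sin y] and writing [cos] through [sin] gives
    [y ^+ 2 <= (1 + y ^+ 2) * sin y ^+ 2]; then divide. *)
Lemma invr_sqr_sin_le (R : realType) (y : R) : `|y| <= pi / 2 -> y != 0 ->
  (sin y ^+ 2)^-1 <= (y ^+ 2)^-1 + 1.
Proof.
move=> yp y0.
wlog yge0 : y yp y0 / 0 <= y.
  move=> H; case: (lerP 0 y) => hy; first exact: H.
  have := H (- y); rewrite normrN oppr_eq0 sinN !sqrrN; apply => //.
  by rewrite oppr_ge0 ltW.
rewrite ger0_norm// in yp.
have ygt0 : 0 < y by rewrite lt_neqAle eq_sym y0.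
have s0 : 0 < sin y by apply: sin_gt0_pi; have := pi_gt0 R; lra.
have c0 : 0 <= cos y by apply: cos_ge0_pihalf; have := pi_gt0 R; lra.
have le1 : y * cos y <= sin y by apply: mulr_cos_le_sin; rewrite yge0.
have le2 : (y * cos y) ^+ 2 <= sin y ^+ 2 by rewrite ler_pXn2r ?nnegrE ?mulr_ge0// ltW.
rewrite exprMn cos2sin2 in le2.
have s2 : 0 < sin y ^+ 2 by rewrite exprn_gt0.
have y2 : 0 < y ^+ 2 by rewrite exprn_gt0.
have -> : (y ^+ 2)^-1 + 1 = (1 + y ^+ 2) / y ^+ 2 by field.
rewrite -div1r ler_pdivrMr// mulrAC ler_pdivlMr//.
lra.
Qed.

Lemma big_nat_double (V : nmodType) (F : nat -> V) (n : nat) :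
  \sum_(0 <= k < n.*2) F k = \sum_(0 <= j < n) (F j.*2 + F j.*2.+1).
Proof.
elim: n => [|n IH]; first by rewrite !big_geq.
by rewrite doubleS !big_nat_recr//= IH addrA.
Qed.

(** Induction on [m], splitting even and odd [k]. The odd nodes shift [y] by [pi / 2 ^+ m.+1], which
    scaling by [2 ^+ m] turns into [pi / 2], so a sine becomes a cosine. The two halves combine by
    [1/sin^2 z + 1/cos^2 z = 4/sin^2(2z)]. *)
Lemma sum_inv_sqr_sin (R : realType) (m : nat) (y : R) :
  sin (2 ^+ m * y) != 0 ->
  \sum_(0 <= k < 2 ^ m) (sin (y + k%:R * (pi / 2 ^+ m)) ^+ 2)^-1 =
  4 ^+ m * (sin (2 ^+ m * y) ^+ 2)^-1.
Proof.
elim: m y => [|m IH] y.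
  by rewrite !expr0 mul1r expn0 big_nat1 !mul0r addr0 mul1r.
have -> : 2 ^+ m.+1 * y = (2 ^+ m * y) *+ 2 by rewrite exprS -mulr_natr; ring.
rewrite sin_mulr2n mulrn_eq0 mulf_eq0 /= negb_or => /andP[c0 s0].
have n2 : 2 ^+ m != 0 :> R by rewrite expf_neq0.
rewrite expnS mul2n big_nat_double big_split /=.
rewrite (eq_bigr (fun k : nat => (sin (y + k%:R * (pi / 2 ^+ m)) ^+ 2)^-1)); last first.
  move=> k _; suff -> : k.*2%:R * (pi / 2 ^+ m.+1) = k%:R * (pi / 2 ^+ m) :> R by [].
  by rewrite -muln2 natrM exprS; field; exact: n2.
rewrite [X in _ + X](eq_bigr (fun k : nat =>
  (sin (y + pi / 2 ^+ m.+1 + k%:R * (pi / 2 ^+ m)) ^+ 2)^-1)); last first.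
  move=> k _; rewrite -addrA.
  suff -> : k.*2.+1%:R * (pi / 2 ^+ m.+1) =
    pi / 2 ^+ m.+1 + k%:R * (pi / 2 ^+ m) :> R by [].
  by rewrite -natr1 -muln2 natrM exprS; field; exact: n2.
have e : 2 ^+ m * (y + pi / 2 ^+ m.+1) = 2 ^+ m * y + pi / 2.
  by rewrite exprS; field; exact: n2.
rewrite IH// IH e sinDpihalf//.
have := cos2Dsin2 (2 ^+ m * y).
move: (cos _) (sin _) c0 s0 => c s c0 s0 h.
rewrite (_ : (_ *+ 2) ^+ 2 = 4 * (c ^+ 2 * s ^+ 2)); last by rewrite -mulr_natr; ring.
have -> : (s ^+ 2)^-1 = (c ^+ 2 + s ^+ 2) / (c ^+ 2 * s ^+ 2) - (c ^+ 2)^-1.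
  by field; rewrite c0 s0.
rewrite h [4 ^+ m.+1]exprS; field; by rewrite c0 s0.
Qed.

(** Put [q = 2 ^+ m.+1]. The numerators [sin^2(pi (t + k))] all equal [sin^2(pi t)], and the nodes
    lie in [(-q/2, q/2)], so the angles [pi (t + k) / q] stay within [pi / 2] of 0. There [1/y^2] is
    at least [1/sin^2 y - 1]; the cosecants sum exactly and the [q] corrections cost at most [1/q]
    together. *)
Lemma sum_sqr_sine_kernel (R : realType) (m : nat) (t : R) :
  - 2 ^+ m < t < 1 - 2 ^+ m ->
  1 - (2 ^+ m.+1)^-1 <= \sum_(0 <= k < 2 ^ m.+1) sine_kernel (t + k%:R) ^+ 2.
Proof.
move=> /andP[t0 t1].
have periodic_sqr (x : R) n : sin (x + n%:R * pi) ^+ 2 = sin x ^+ 2.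
  elim: n => [|n IH]; first by rewrite mul0r addr0.
  by rewrite -natr1 mulrDl mul1r addrA sinDpi sqrrN IH.
have p2 : 0 < 2 ^+ m :> R by rewrite exprn_gt0.
have pi0 := pi_gt0 R.
(* Adding [2 ^ m] half-periods moves the angle into []0, pi[] without changing the squared sine. *)
have hs : sin (pi * t) != 0.
  rewrite -sqrf_eq0 -(periodic_sqr _ (2 ^ m)%N) sqrf_eq0 gt_eqF//.
  rewrite mulrC -mulrDl natrX sin_gt0_pi//; apply/andP; split; nra.
set q : R := 2 ^+ m.+1.
have qE : q = 2 * 2 ^+ m by rewrite /q exprS.
have q0 : 0 < q by rewrite qE; lra.
have qn0 : q != 0 by rewrite gt_eqF.
have hs' : sin (q * (pi * t / q)) != 0.
  by rewrite mulrC divfK.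
have := @sum_inv_sqr_sin R m.+1 (pi * t / q) hs'.
rewrite -/q [q * _]mulrC divfK// => E.
have s2 : sin (pi * t) ^+ 2 != 0 by rewrite sqrf_eq0.
have q2 : 4 ^+ m.+1 = q ^+ 2 by rewrite /q -exprM mulnC exprM; congr (_ ^+ _); ring.
(* The loss [1/q] is shared out as [1/q^2] per node, so that the comparison can be made term by
   term. *)
have -> : 1 - q^-1 = (sin (pi * t) ^+ 2) / q ^+ 2 *
    (4 ^+ m.+1 * (sin (pi * t) ^+ 2)^-1) - q / q ^+ 2.
  rewrite q2; field. by rewrite hs qn0.
rewrite -E mulr_sumr.
have -> : q / q ^+ 2 = \sum_(0 <= k < 2 ^ m.+1) (q ^+ 2)^-1.
  by rewrite sumr_const_nat subn0 -mulr_natr natrX -/q mulrC.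
rewrite -sumrB !big_mkord; apply: ler_sum => k _ /=.
set u := t + k%:R.
have uE : pi * t / q + k%:R * (pi / q) = pi * u / q.
  by rewrite /u; field; rewrite gt_eqF//.
have us : sin (pi * u) ^+ 2 = sin (pi * t) ^+ 2.
  by rewrite /u mulrDr [pi * k%:R]mulrC periodic_sqr.
have u0 : u != 0.
  apply: contraNneq s2 => u0; by rewrite -us u0 mulr0 sin0 expr0n.
rewrite /sine_kernel (negbTE u0) uE expr_div_n us.
have ub : `|pi * u / q| <= pi / 2.
  rewrite normrM normfV (gtr0_norm q0) ler_pdivrMr//.
  rewrite normrM (gtr0_norm pi0) -mulrA ler_pM2l// qE mulrA mulVf// mul1r.
  have : k%:R <= q - 1.
    by rewrite /q -natrX lerBrDr natr1 ler_nat ltn_ord.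
  by have := ler0n R k; rewrite /u qE ler_norml => ? ?; apply/andP; split; lra.
have pu : pi * u / q != 0.
  by rewrite !mulf_eq0 invr_eq0 !negb_or u0 qn0 gt_eqF.
have := @invr_sqr_sin_le R _ ub pu.
set A := (sin _ ^+ 2)^-1 => hA.
have sle : sin (pi * t) ^+ 2 <= 1 by rewrite -(cos2Dsin2 (pi * t)) lerDr sqr_ge0.
have sge : 0 <= sin (pi * t) ^+ 2 by rewrite sqr_ge0.
have : sin (pi * t) ^+ 2 / q ^+ 2 * A <= sin (pi * t) ^+ 2 / q ^+ 2 * (((pi * u / q) ^+ 2)^-1 + 1).
  by rewrite ler_wpM2l// divr_ge0// sqr_ge0.
have aux (a b c d : R) : b != 0 -> c != 0 -> d != 0 ->
    a / d ^+ 2 * (((b * c / d) ^+ 2)^-1 + 1) = a / (b * c) ^+ 2 + a / d ^+ 2.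
  by move=> b0 c0 d0; field; rewrite b0 c0 d0.
rewrite aux //; last by rewrite gt_eqF.
have : sin (pi * t) ^+ 2 / q ^+ 2 <= (q ^+ 2)^-1.
  by rewrite ler_piMl// invr_ge0 sqr_ge0.
lra.
Qed.

(** * Continuity of the sine kernel *)

(** At 0 the kernel is [pi^-1] times the difference quotient of [sin (pi * z)], whose limit is the
    derivative [pi]. *)
Lemma continuous_sine_kernel (R : realType) : continuous (@sine_kernel R).
Proof.
move=> x; have [->|x0] := eqVneq x 0.
  apply/continuous_withinNx => /=.
  rewrite /sine_kernel eqxx.
  have d0 : is_derive (0 : R) (1 : R) (fun z : R => sin (pi * z)) (pi * cos (pi * 0)).
    apply: is_derive_eq; rewrite /GRing.scale/=; ring.
  have := @ex_derive _ _ _ _ _ _ _ d0.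
  move=> /cvg_ex[l hl]; have := hl.
  have -> : l = pi.
    have := @derive_val _ _ _ _ _ _ _ d0; rewrite mulr0 cos0 mulr1 => <-.
    by apply/esym; exact: cvg_lim hl.
  move=> {}hl.
  have : pi^-1 * (h^-1 *: (sin (pi * (h *: 1 + 0)) - sin (pi * 0)))
    @[h --> (0 : R)^'] --> pi^-1 * pi.
    by apply: cvgM; [exact: cvg_cst|exact: hl].
  rewrite mulVf ?gt_eqF ?pi_gt0//.
  apply: cvg_trans; apply: near_eq_cvg; near=> h.
  have h0 : h != 0 by near: h; exact: nbhs_dnbhs_neq.
  rewrite /sine_kernel (negbTE h0) mulr0 sin0 subr0 addr0 /GRing.scale/= mulr1.
  by rewrite mulrA mulrC invfM.
have : {for x, continuous (fun z : R => sin (pi * z) / (pi * z))}.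
  apply: cvgM.
    apply: continuous_comp; last exact: continuous_sin.
    by apply: cvgM; [exact: cvg_cst|exact: cvg_id].
  apply: cvgV; first by rewrite mulf_neq0// gt_eqF// pi_gt0.
  by apply: cvgM; [exact: cvg_cst|exact: cvg_id].
rewrite /prop_for /continuous_at [sine_kernel x]/sine_kernel (negbTE x0).
apply: cvg_trans; apply: near_eq_cvg; near=> z.
have z0 : z != 0 by near: z; apply: open_neq => //.
by rewrite /sine_kernel (negbTE z0).
Unshelve. all: by end_near. Qed.

(** Heine's theorem with only [y] confined to the segment. Compactness is used as near-covering,
    along the filter of radii [d] tending to 0 from the right. *)
Lemma continuous_unif_segment (R : realType) (f : R -> R) (M e : R) :
  continuous f -> 0 < e ->
  exists2 d, 0 < d & forall y z, `|y| <= M -> `|z - y| <= d -> `|f z - f y| < e.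
Proof.
move=> cf e0.
have /compact_near_coveringP/(_ R ((0:R)^'+)
    (fun d y => forall z, `|z - y| <= d -> `|f z - f y| < e)) :=
  @segment_compact R (- M) M.
move=> /(_ _)[].
  move=> x _.
  have /cvgrPdist_lt/(_ (e / 2))/(_ _)[] := cf x; first by rewrite divr_gt0.
  move=> r /= r0 hr.
  exists (ball x (r / 2), [set d | d < r / 2]).
    by split; [apply: nbhsx_ballx|apply: nbhs_right_lt]; rewrite divr_gt0.
  move=> [x' d]/= [xx' dr] z zx'.
  have h1 : `|f x - f x'| < e / 2.
    by apply: hr; apply: lt_trans xx' _; rewrite ltr_pdivrMr// ltr_pMr// ltr1n.
  have h2 : `|f x - f z| < e / 2.
    apply: hr; rewrite /ball/=.
    rewrite (_ : x - z = (x - x') - (z - x')); last by ring.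
    apply: le_lt_trans (ler_normB _ _) _.
    rewrite [r]splitr ltrD//; exact: le_lt_trans dr.
  rewrite (_ : f z - f x' = (f x - f x') - (f x - f z)); last by ring.
  apply: le_lt_trans (ler_normB _ _) _.
  by rewrite [e]splitr ltrD.
move=> r /= r0 hr; exists (r / 2); first by rewrite divr_gt0.
move=> y z yM; apply: (hr (r / 2)) => /=.
- by rewrite sub0r normrN gtr0_norm ?divr_gt0// ltr_pdivrMr// ltr_pMr// ltr1n.
- by rewrite divr_gt0.
- by rewrite in_itv/= -ler_norml.
Qed.

(** * Growth of the diagonal kernel *)

Lemma bulk_universality_near (R : realType) (w : R -> R) (p : nat -> {poly R})
    (x0 A e : R) : 0 < e ->
  bulk_universality w p x0 ->
  \forall n \near \oo, forall a b, `|a| <= A -> `|b| <= A ->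
  `|CD_kernel p n (x0 + a / weighted_CD_kernel w p n x0 x0)
                      (x0 + b / weighted_CD_kernel w p n x0 x0)
        / CD_kernel p n x0 x0 - sine_kernel (b - a)| < e.
Proof.
move=> e0 /(_ `[- A, A]%classic `[- A, A]%classic
  (@segment_compact _ _ _) (@segment_compact _ _ _)).
move=> H.
pose P : set (R * R -> R) := [set g | forall ab, (`[- A, A]%classic `*` `[- A, A]%classic) ab ->
  `|g ab - sine_kernel (ab.2 - ab.1)| < e].
have := H P; case.
  apply/uniform_nbhs; exists [set xy | ball xy.1 e xy.2]; split.
    by rewrite -entourage_ballE; exists e.
  by move=> h hE ab /hE; rewrite /ball/= distrC.
move=> N _ hN; exists N => // n Nn a b aA bA.
by apply: (hN n Nn (a, b)); split; rewrite /= in_itv/= -ler_norml.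
Qed.

Lemma CD_kernel_diag_le (R : realType) (p : nat -> {poly R}) m n (x : R) : (m <= n)%N ->
  CD_kernel p m x x <= CD_kernel p n x x.
Proof.
move=> /subnK <-; elim: (n - m)%N => // k IH; apply: le_trans IH _.
by rewrite /CD_kernel addSn big_ord_recr/= lerDl -expr2 sqr_ge0.
Qed.

Lemma CD_kernel_diag_ge0 (R : realType) (p : nat -> {poly R}) n (x : R) : 0 <= CD_kernel p n x x.
Proof. by apply: sumr_ge0 => i _; rewrite -expr2 sqr_ge0. Qed.

Lemma CD_kernel_diag_gt0 (R : realType) (p : nat -> {poly R}) n (x : R) :
  size (p 0) = 1%N -> (0 < n)%N ->
  0 < CD_kernel p n x x.
Proof.
move=> s0 n0; apply: lt_le_trans (CD_kernel_diag_le _ _ n0).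
rewrite /CD_kernel big_ord1 -expr2 exprn_even_gt0//=.
have /eqP/size_poly1P[c c0 ->] := s0.
by rewrite hornerC c0.
Qed.

Lemma CD_kernel_diag_cvgy (R : realType) (w : R -> R) (p : nat -> {poly R}) (x0 : R) : 0 < w x0 ->
  size (p 0) = 1%N -> size (p 1) = 2%N ->
  bulk_universality w p x0 ->
  forall C, \forall n \near \oo, C < CD_kernel p n x0 x0.
Proof.
move=> w0 sp0 sp1 huniv C; apply: contrapT => hC.
have {hC}bdd n : CD_kernel p n x0 x0 <= C.
  rewrite leNgt; apply/negP => hn; apply: hC; exists n => // m /= nm.
  exact: lt_le_trans hn (CD_kernel_diag_le _ _ nm).
have C0 : 0 <= C by apply: le_trans (bdd 0); exact: CD_kernel_diag_ge0.
(* [p 1] has degree one, so it takes every value. The value [C + 2] is chosen because [(C + 2) ^+ 2]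
   exceeds [2 * C]. *)
have [s hs] : exists s, (p 1).[x0 + s] = C + 2.
  exists ((C + 2 - (p 1)`_0) / (p 1)`_1 - x0).
  have h1 : (p 1)`_1 != 0.
    by have := lead_coef_eq0 (p 1); rewrite /lead_coef sp1 /= => ->; rewrite -size_poly_eq0 sp1.
  rewrite horner_coef sp1 big_ord_recl big_ord1 /= expr0 expr1; field.
  by rewrite h1.
(* While the kernel stays below [C], the fixed displacement [s] has a rescaled coordinate in this
   fixed compact set, for every [n]. Error 1 around [sine_kernel 0 = 1] bounds the ratio by 2. *)
have [N _ hN] := bulk_universality_near (`|s| * (w x0 * C)) ltr01 huniv.
(* At least 2, so that the kernel contains the term of [p 1]. *)
pose n := maxn N 2.
have n2 : (2 <= n)%N by rewrite leq_maxr.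
have K0 : 0 < CD_kernel p n x0 x0 by apply: CD_kernel_diag_gt0 => //; exact: leq_trans n2.
have wK : weighted_CD_kernel w p n x0 x0 = w x0 * CD_kernel p n x0 x0.
  by rewrite /weighted_CD_kernel -expr2 sqr_sqrtr// ltW.
have c0 : 0 < weighted_CD_kernel w p n x0 x0 by rewrite wK mulr_gt0.
have aA : `|s * weighted_CD_kernel w p n x0 x0| <= `|s| * (w x0 * C).
  by rewrite normrM ler_wpM2l// gtr0_norm// wK ler_wpM2l// ltW.
have := hN n (leq_maxl _ _) _ _ aA aA.
rewrite mulfK ?gt_eqF// subrr /sine_kernel eqxx ltr_norml => /andP[_].
rewrite ltrBlDr ltr_pdivrMr//.
have := bdd n.
have : (C + 2) ^+ 2 <= CD_kernel p n (x0 + s) (x0 + s).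
  apply: (@le_trans _ _ (CD_kernel p 2 (x0 + s) (x0 + s))); last exact: CD_kernel_diag_le.
  by rewrite /CD_kernel big_ord_recr /= -hs -expr2 lerDr sumr_ge0// => i _; rewrite -expr2 sqr_ge0.
nra.
Qed.

(** * The reproducing property *)

Lemma integrable_horner (R : realType)
    (mu : {measure set (measurableTypeR R) -> \bar R}) (q : {poly R}) : finite_moments mu ->
  mu.-integrable setT (fun y : R => q.[y]%:E).
Proof.
move=> hmom.
under eq_fun do rewrite horner_coef -sumEFin.
apply: integrable_sum => //= i _.
under eq_fun do rewrite EFinM.
by apply: integrableZl => //; exact: hmom.
Qed.

Lemma CD_kernelE (R : realType) (p : nat -> {poly R}) n (x y : R) :
  CD_kernel p n x y = (\sum_(j < n) (p j).[x] *: p j).[y].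
Proof. by rewrite horner_sum; apply: eq_bigr => j _; rewrite hornerZ. Qed.

(** The square is expanded into a double sum and integrated termwise, which the finite moments
    justify; orthonormality keeps only the diagonal terms. *)
Lemma integral_sqr_CD_kernel (R : realType)
    (mu : {measure set (measurableTypeR R) -> \bar R})
    (p : nat -> {poly R}) n (x : R) : finite_moments mu ->
  orthonormal_polynomials mu p ->
  (\int[mu]_y (CD_kernel p n x y ^+ 2)%:E = (CD_kernel p n x x)%:E)%E.
Proof.
move=> hmom [_ _ ho].
have E y : (CD_kernel p n x y ^+ 2)%:E =
    (\sum_(i < n) \sum_(j < n) ((p i).[x] * (p j).[x])%:E * ((p i).[y] * (p j).[y])%:E)%E.
  rewrite expr2 /CD_kernel mulr_suml -sumEFin; apply: eq_bigr => i _.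
  rewrite mulr_sumr -sumEFin; apply: eq_bigr => j _.
  by rewrite -EFinM; congr (_%:E); ring.
have int (i j : 'I_n) : mu.-integrable setT (fun y : R => ((p i).[y] * (p j).[y])%:E).
  by under eq_fun do rewrite -hornerM; exact: integrable_horner.
have intZ (i j : 'I_n) : mu.-integrable setT
    (fun y : R => (((p i).[x] * (p j).[x])%:E * ((p i).[y] * (p j).[y])%:E)%E).
  by apply: integrableZl.
under eq_integral do rewrite E.
rewrite integral_sum//; last by move=> i; exact: integrable_sum.
rewrite /CD_kernel -sumEFin; apply: eq_bigr => i _.
rewrite integral_sum//.
rewrite (bigD1 i)//= big1 ?adde0.
  by rewrite integralZl// ho eqxx mule1.
move=> j ji; rewrite integralZl// ho.
by rewrite -val_eqE eq_sym in ji; rewrite (negbTE ji) mule0.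
Qed.

Lemma measurable_CD_kernel (R : realType) (p : nat -> {poly R}) n (x : R)
    (D : set (measurableTypeR R)) :
  measurable_fun D (fun y : measurableTypeR R => CD_kernel p n x y : measurableTypeR R).
Proof.
apply: measurable_funTS; under eq_fun do rewrite CD_kernelE.
apply: continuous_measurable_fun => y; exact: continuous_horner.
Qed.

(** * Lower bounds for integrals and masses on small cells *)

(** A lower Darboux sum: monotonicity of [b] makes the half-open cells disjoint, and nonnegativity
    of [f] discards what they leave of [A]. *)
Lemma cell_sum_le_integral (R : realType)
    (mu : {measure set (measurableTypeR R) -> \bar R})
    (f : R -> \bar R) (b c : nat -> R) (J : nat)
    (A : set R) :
  measurable A -> measurable_fun A (f : measurableTypeR R -> \bar R) ->
  (forall y, A y -> (0 <= f y)%E) ->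
  {homo b : k l / (k <= l)%N >-> k <= l} ->
  (forall k, (k < J)%N -> `[b k, b k.+1[%classic `<=` A) ->
  (forall k, (k < J)%N -> forall y, `[b k, b k.+1[%classic y -> ((c k)%:E <= f y)%E) ->
  (forall k, 0 <= c k) ->
  (\sum_(0 <= k < J) (c k)%:E * mu `[b k, b k.+1[%classic <= \int[mu]_(y in A) f y)%E.
Proof.
move=> mA mf f0 bmono bA cf c0.
have mcell k : measurable (`[b k, b k.+1[%classic : set (measurableTypeR R)).
  exact: measurable_itv.
have UA : \big[setU/set0]_(k <- index_iota 0 J) `[b k, b k.+1[%classic `<=` A.
  rewrite -bigcup_seq => y [k /=]; rewrite mem_index_iota => /andP[_ kJ].
  exact: bA.
apply: (@le_trans _ _
  (\int[mu]_(y in \big[setU/set0]_(k <- index_iota 0 J) `[b k, b k.+1[%classic) f y)%E); last first.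
  apply: ge0_subset_integral => //.
  exact: bigsetU_measurable.
rewrite ge0_integral_bigsetU//.
- rewrite big_seq [leRHS]big_seq; apply: lee_sum => k; rewrite mem_index_iota => /andP[_ kJ].
  rewrite -integral_cst//; apply: ge0_le_integral => //.
  + by move=> y _; rewrite lee_fin.
  + by apply: measurable_funS mf => //; exact: bA.
  + exact: cf.
- exact: iota_uniq.
- apply/trivIsetP => k l _ _ kl.
  wlog {kl} kl : k l / (k < l)%N.
    move=> H; move: kl; rewrite neq_ltn => /orP[] h; first exact: H.
    by rewrite setIC; exact: H.
  rewrite -subset0 => y [] /=; rewrite !in_itv/= => /andP[_ h1] /andP[h2 _].
  by have := bmono _ _ kl => h3; have := lt_le_trans h1 (le_trans h3 h2); rewrite ltxx.
- by apply: measurable_funS mf.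
- by move=> y /UA; exact: f0.
Qed.

(** Integrate [w x0 <= w x + |w x - w x0|] over the cell; the singular part only adds mass. The
    error is enlarged to a window centred at [x0], since a Lebesgue point controls averages on such
    windows. *)
Lemma cell_measure_ge (R : realType)
    (mu : {measure set (measurableTypeR R) -> \bar R}) (w : R -> R)
    (mu_sing : {measure set (measurableTypeR R) -> \bar R}) (x0 e a b : R) :
  lebesgue_decomposition mu w mu_sing -> 0 <= w x0 -> a <= b ->
  `[a, b[%classic `<=` `]x0 - e, x0 + e[%classic ->
  ((w x0 * (b - a))%:E <= mu `[a, b[%classic +
    \int[@lebesgue_measure R]_(x in `]x0 - e, x0 + e[%classic%R) `|(w x - w x0)%R|%:E)%E.
Proof.
move=> [mw w0 _ dec] wx0 ab sub.
have mab : measurable (`[a, b[%classic : set (measurableTypeR R)) by exact: measurable_itv.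
have mwE : measurable_fun setT (fun x : measurableTypeR R => `|w x - w x0|%:E).
  apply/measurable_EFinP; apply: measurableT_comp => //.
  by apply: measurable_funB.
have mwE' : measurable_fun setT (fun x : measurableTypeR R => (w x)%:E).
  exact/measurable_EFinP.
apply: (@le_trans _ _
  (\int[@lebesgue_measure R]_(x in `[a, b[%classic) ((w x)%:E + `|(w x - w x0)%R|%:E)))%E.
  rewrite EFinM.
  have -> : ((b - a)%:E = @lebesgue_measure R `[a, b[%classic)%E.
    rewrite lebesgue_measure_itv/= lte_fin; case: ltP => // ba.
    by rewrite (_ : b = a) ?subrr//; apply/eqP; rewrite eq_le ab ba.
  rewrite -integral_cst//; apply: ge0_le_integral => //.
  - by apply: measurable_funTS; apply: emeasurable_funD.
  - move=> y _; rewrite -EFinD lee_fin.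
    by have := ler_norm (w x0 - w y); rewrite distrC; lra.
rewrite ge0_integralD//; last 3 first.
- by move=> y _; rewrite lee_fin.
- exact: measurable_funTS.
- exact: measurable_funTS.
apply: leeD.
  by rewrite dec// leeDl.
apply: ge0_subset_integral => //; first exact: measurable_funTS.
Qed.

(** * Riemann sums and elementary estimates *)

Lemma big_nat_mul (V : nmodType) (F : nat -> V) (L N : nat) :
  \sum_(0 <= k < L * N) F k =
  \sum_(0 <= i < N) \sum_(0 <= l < L) F (l * N + i)%N.
Proof.
elim: L => [|L IH].
  by rewrite mul0n big_geq// big1// => i _; rewrite big_geq.
rewrite mulSnr (@big_cat_nat _ _ _ (L * N))//= ?leq_addr// IH.
rewrite -[X in _ + \sum_(X <= _ < _) _]add0n big_addn addKn -big_split/=.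
by apply: eq_bigr => i _; rewrite big_nat_recr//= addnC.
Qed.

(** The nodes are midpoints of cells of length [1/N] in [[-2^m, 2^m]]. Each residue class of indices
    modulo [N] is a unit-spaced progression, to which [sum_sqr_sine_kernel] applies; the half step
    keeps its first node strictly between consecutive integers. *)
Lemma riemann_sum_sine_kernel (R : realType) (m N : nat) : (0 < N)%N ->
  N%:R * (1 - (2 ^+ m.+1)^-1) <=
  \sum_(0 <= k < 2 ^ m.+1 * N)
    sine_kernel (- 2 ^+ m + (k%:R + 2^-1) * N%:R^-1 : R) ^+ 2.
Proof.
move=> N0; rewrite big_nat_mul.
have NR : 0 < N%:R :> R by rewrite ltr0n.
have -> : N%:R * (1 - (2 ^+ m.+1)^-1) = \sum_(0 <= i < N) (1 - (2 ^+ m.+1)^-1) :> R.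
  by rewrite sumr_const_nat subn0 mulr_natl.
rewrite big_seq [leRHS]big_seq; apply: ler_sum => i.
rewrite mem_index_iota => /andP[_ iN].
have iN' : i%:R + 1 <= N%:R :> R by rewrite natr1 ler_nat.
pose t : R := - 2 ^+ m + (i%:R + 2^-1) * N%:R^-1.
have h : - 2 ^+ m < t < 1 - 2 ^+ m.
  have i0 := ler0n R i.
  have : 0 < (i%:R + 2^-1) * N%:R^-1 :> R by rewrite mulr_gt0 ?invr_gt0//; lra.
  have : (i%:R + 2^-1) * N%:R^-1 < 1 :> R by rewrite ltr_pdivrMr//; lra.
  by rewrite /t => ? ?; apply/andP; split; lra.
apply: le_trans (sum_sqr_sine_kernel h) _.
apply: ler_sum => l _.
rewrite (_ : t + l%:R =
  - 2 ^+ m + ((l * N + i)%:R + 2^-1) * N%:R^-1)//.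
by rewrite /t natrD natrM; field; rewrite gt_eqF.
Qed.

(** Equivalent to [v^2 <= (1 + t) (u^2 + t)]: with [d = u - v], expand [(u - d)^2] and use
    [2 |u| t <= t (1 + u^2)]. *)
Lemma sqr_perturb_ge (R : realFieldType) (t u v : R) : 0 < t ->
  `|u - v| <= t -> v ^+ 2 / (1 + t) - t <= u ^+ 2.
Proof.
move=> t0; rewrite ler_norml => /andP[h1 h2].
rewrite lerBlDr ler_pdivrMr; last by lra.
have -> : v = u - (u - v) by ring.
move: (u - v) h1 h2 => d h1 h2.
have : d ^+ 2 <= t ^+ 2 by nra.
have : - (2 * u * d) <= t * (1 + u ^+ 2).
  have [u0|u0] := lerP 0 u.
    have : 0 <= t * (1 - u) ^+ 2 by rewrite mulr_ge0 ?sqr_ge0// ltW.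
    have : 0 <= u * (d + t) by rewrite mulr_ge0//; lra.
    lra.
  have : 0 <= t * (1 + u) ^+ 2 by rewrite mulr_ge0 ?sqr_ge0// ltW.
  have : 0 <= (- u) * (t - d) by rewrite mulr_ge0//; lra.
  lra.
lra.
Qed.

Lemma lebesgue_point_near (R : realType) (w : R -> R) mu_sing (x0 t : R) :
  0 < t -> lebesgue_point w mu_sing x0 ->
  exists2 r0, 0 < r0 & forall r, 0 < r < r0 ->
  (\int[@lebesgue_measure R]_(x in `]x0 - r, x0 + r[%classic%R)
          `|(w x - w x0)%R|%:E <= (2 * r * t)%:E)%E.
Proof.
move=> t0 [_ _ h].
have : nbhs (0 : \bar R)%E [set x | (x < t%:E)%E].
  by apply: open_nbhs_nbhs; split; [exact: open_ereal_lt_ereal|rewrite /= lte_fin].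
move=> /h[r0 /= r00 hr0]; exists r0 => // r /andP[r1 r2].
have := hr0 r; rewrite /= sub0r normrN gtr0_norm// => /(_ r2 r1).
by rewrite lte_pdivrMl ?mulr_gt0// -EFinM => /ltW.
Qed.

Lemma exists_inv_exp2_le (R : realType) (e : R) : 0 < e ->
  exists m, (2 ^+ m.+1)^-1 <= e.
Proof.
move=> e0; exists (Num.bound e^-1).
rewrite -[leRHS]invrK lef_pV2 ?posrE ?invr_gt0 ?exprn_gt0//.
have := archi_boundP (ltW (_ : 0 < e^-1)); rewrite invr_gt0 => /(_ e0).
move/ltW/le_trans; apply; rewrite -natrX ler_nat.
exact: leq_trans (leqnSn _) (ltnW (ltn_expl _ (isT : (1 < 2)%N))).
Qed.

(** * Mass of the squared kernel near the point *)

(** Universality at [a = 0] costs [eta], and moving [b] to the midpoint of its cell costs another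
    [eta]; hence [2 * eta] in [sqr_perturb_ge]. The maximum with 0 provides the nonnegative
    constants that [cell_sum_le_integral] requires. *)
Lemma CD_kernel_cell_ge (R : realType) (w : R -> R) (p : nat -> {poly R})
    (x0 : R) (n N : nat) (M eta d : R) :
  0 < CD_kernel p n x0 x0 -> (0 < N)%N -> N%:R^-1 <= d -> 0 < eta ->
  (forall y z : R, `|y| <= M -> `|z - y| <= d ->
    `|sine_kernel z - sine_kernel y| < eta) ->
  (forall a b, `|a| <= M -> `|b| <= M ->
  `|CD_kernel p n (x0 + a / weighted_CD_kernel w p n x0 x0)
                      (x0 + b / weighted_CD_kernel w p n x0 x0)
        / CD_kernel p n x0 x0 - sine_kernel (b - a)| < eta) ->
  forall (k : nat) (b : R), (k.+1%:R) / N%:R <= 2 * M ->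
  - M + k%:R / N%:R <= b < - M + k.+1%:R / N%:R ->
  CD_kernel p n x0 x0 *
    Num.max 0 (sine_kernel (- M + (k%:R + 2^-1) / N%:R) ^+ 2 / (1 + 2 * eta) - 2 * eta) <=
  CD_kernel p n x0 (x0 + b / weighted_CD_kernel w p n x0 x0) ^+ 2 / CD_kernel p n x0 x0.
Proof.
move=> K0 N0 Nd eta0 hunif hn k b kM /andP[b1 b2].
set K := CD_kernel p n x0 x0 in K0 hn *; set c := weighted_CD_kernel w p n x0 x0 in hn *.
set v := CD_kernel p n x0 _.
have -> : v ^+ 2 / K = K * (v / K) ^+ 2 by field; rewrite gt_eqF.
rewrite ler_pM2l// ge_max sqr_ge0/=.
have NR : 0 < N%:R :> R by rewrite ltr0n.
have h0 : 0 < N%:R^-1 :> R by rewrite invr_gt0.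
have kS : k.+1%:R / N%:R = k%:R / N%:R + N%:R^-1 :> R by rewrite -natr1 mulrDl mul1r.
have k2 : (k%:R + 2^-1) / N%:R = k%:R / N%:R + 2^-1 * N%:R^-1 :> R by rewrite mulrDl.
have kN0 : 0 <= k%:R / N%:R :> R by rewrite divr_ge0.
rewrite kS in kM b2; rewrite k2.
move: (k%:R / N%:R) kM b1 b2 kN0 {kS k2} => u kM b1 b2 u0.
set s := - M + _.
have sM : `|s| <= M by rewrite ler_norml /s; apply/andP; split; lra.
have bM : `|b| <= M by rewrite ler_norml; apply/andP; split; lra.
have M0 : `|0 : R| <= M by rewrite normr0; exact: le_trans bM.
have bs : `|b - s| <= d.
  by apply: le_trans Nd; rewrite ler_norml /s; apply/andP; split; lra.
have h1 := hunif s b sM bs.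
have := hn 0 b M0 bM; rewrite mul0r addr0 subr0 -/v => h2.
apply: sqr_perturb_ge; first by lra.
rewrite (_ : _ - _ = (v / K - sine_kernel b) + (sine_kernel b - sine_kernel s)); last by ring.
by apply: le_trans (ler_normD _ _) _; lra.
Qed.

Lemma CD_kernel_mass_near (R : realType)
    (mu : probability (measurableTypeR R) R) (w : R -> R)
    (mu_sing : {measure set (measurableTypeR R) -> \bar R})
    (p : nat -> {poly R}) (x0 e delta : R) :
  lebesgue_decomposition mu w mu_sing -> orthonormal_polynomials mu p ->
  lebesgue_point w mu_sing x0 -> bulk_universality w p x0 ->
  0 < e -> 0 < delta ->
  \forall n \near \oo, ((1 - e)%:E <=
    \int[mu]_(y in `]x0 - delta, x0 + delta[%classic%R)
      (CD_kernel p n x0 y ^+ 2 / CD_kernel p n x0 x0)%:E)%E.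
Proof.
move=> hdec hp hleb huniv; wlog e1 : e / e < 1.
  move=> H e0 delta0; have [e1|e1] := ltP e 1; first exact: H.
  have h2 : 0 < 2^-1 :> R by rewrite invr_gt0.
  have h3 : 2^-1 < 1 :> R by rewrite invf_lt1// ltr1n.
  have := H 2^-1 h3 h2 delta0; apply: filterS => n; apply: le_trans.
  by rewrite lee_fin; lra.
move=> e0 delta0.
have [w0 _ _] := hleb.
have [sp _ _] := hp.
have [m hm] : exists m, (2 ^+ m.+1)^-1 <= e / 4 by apply: exists_inv_exp2_le; lra.
set M : R := 2 ^+ m; set L := (2 ^ m.+1)%N.
have LM : L%:R = 2 * M :> R by rewrite /L natrX exprS.
have M0 : 0 < M by rewrite exprn_gt0.
rewrite -natrX -/L LM in hm.
(* The factor [1 / (1 + 2 * eta)] and the loss [2 * eta] on each of the [2 * M * N] cells cost,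
   relative to [N], at most [2 * eta * (1 + 2 * M) = e / 4]; truncation to [[-M, M]] costs another
   [e / 4]. *)
pose eta := e / (8 * (1 + 2 * M)).
have eta0 : 0 < eta by rewrite divr_gt0// mulr_gt0//; lra.
have [d d0 hunif] := continuous_unif_segment M (@continuous_sine_kernel R) eta0.
have [N N0 Nd] : exists2 N, (0 < N)%N & N%:R^-1 <= d.
  exists (Num.bound d^-1).+1 => //.
  rewrite -[leRHS]invrK lef_pV2 ?posrE ?invr_gt0//.
  have := archi_boundP (ltW (_ : 0 < d^-1)); rewrite invr_gt0 => /(_ d0)/ltW.
  by move/le_trans; apply; rewrite ler_nat.
have NR : 0 < N%:R :> R by rewrite ltr0n.
pose h : R := N%:R^-1.
have h0 : 0 < h by rewrite invr_gt0.
(* [tau] is the loss per cell caused by [|w - w x0|], in units where a cell has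
   length [h]. *)
pose tau := h * (e / 2).
have tau0 : 0 < tau by rewrite mulr_gt0//; lra.
(* With this average and radius [2 * M / c], where [c = w x0 * K], the error integral is at most
   [w x0 * tau / c], which is [tau] after multiplication by [K]. *)
have th0 : 0 < w x0 * tau / (4 * M) by rewrite !mulr_gt0// invr_gt0 mulr_gt0.
have [r0 r00 hr0] := lebesgue_point_near th0 hleb.
near=> n.
have K0 : 0 < CD_kernel p n x0 x0.
  by near: n; exact: (CD_kernel_diag_cvgy w0 (sp 0%N) (sp 1%N) huniv).
(* One threshold for two demands: [2 * M / c < r0] and [M / c < delta]. *)
have hK : (2 * M / r0 + M / delta) / w x0 < CD_kernel p n x0 x0.
  by near: n; exact: (CD_kernel_diag_cvgy w0 (sp 0%N) (sp 1%N) huniv).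
have hn : forall a b, `|a| <= M -> `|b| <= M ->
  `|CD_kernel p n (x0 + a / weighted_CD_kernel w p n x0 x0)
                      (x0 + b / weighted_CD_kernel w p n x0 x0)
        / CD_kernel p n x0 x0 - sine_kernel (b - a)| < eta.
  by near: n; exact: bulk_universality_near.
have cell := CD_kernel_cell_ge K0 N0 Nd eta0 hunif hn.
have cE : weighted_CD_kernel w p n x0 x0 = w x0 * CD_kernel p n x0 x0.
  by rewrite /weighted_CD_kernel -expr2 sqr_sqrtr// ltW.
set c := weighted_CD_kernel w p n x0 x0 in cE cell hn.
set K := CD_kernel p n x0 x0 in cE cell hn K0 hK *.
have c0 : 0 < c by rewrite cE mulr_gt0.
rewrite ltr_pdivrMr// [K * _]mulrC -cE in hK.
have hr : 0 < 2 * M / c < r0.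
  apply/andP; split; first by rewrite divr_gt0// mulr_gt0.
  rewrite ltr_pdivrMr// [r0 * c]mulrC -ltr_pdivrMr//.
  by apply: le_lt_trans hK; rewrite lerDl divr_ge0// ltW.
have hd : M / c < delta.
  rewrite ltr_pdivrMr// mulrC -ltr_pdivrMr//.
  by apply: le_lt_trans hK; rewrite lerDr divr_ge0// ?mulr_ge0// ltW.
pose b k : R := x0 + (- M + k%:R / N%:R) / c.
pose q k : R := sine_kernel (- M + (k%:R + 2^-1) / N%:R).
pose g k : R := K * Num.max 0 (q k ^+ 2 / (1 + 2 * eta) - 2 * eta).
have bmono : {homo b : k l / (k <= l)%N >-> k <= l}.
  move=> k l kl; rewrite lerD2l ler_pM2r ?invr_gt0// lerD2l ler_pM2r ?invr_gt0//.
  by rewrite ler_nat.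
have kM k : (k < L * N)%N -> k.+1%:R / N%:R <= 2 * M.
  by move=> kLN; rewrite ler_pdivrMr// -LM -natrM ler_nat.
have cellin k : (k < L * N)%N -> forall y, `[b k, b k.+1[%classic y ->
    - M <= (y - x0) * c < M /\
    - M + k%:R / N%:R <= (y - x0) * c < - M + k.+1%:R / N%:R.
  move=> kLN y /=; rewrite in_itv/= /b -lerBrDl -ltrBlDl.
  rewrite ler_pdivrMr// ltr_pdivlMr// => /andP[h1 h2].
  have h3 := kM k kLN; have h4 : 0 <= k%:R / N%:R :> R by rewrite divr_ge0.
  by split; apply/andP; split => //; lra.
have bA r : M / c < r -> forall k, (k < L * N)%N ->
    `[b k, b k.+1[%classic `<=` `]x0 - r, x0 + r[%classic.
  move=> Mr k kLN y /(cellin k kLN)[/andP[h1 h2] _] /=.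
  rewrite ltr_pdivrMr// in Mr.
  have h3 : - r < y - x0 by rewrite -(ltr_pM2r c0); lra.
  have h4 : y - x0 < r by rewrite -(ltr_pM2r c0); lra.
  by rewrite in_itv/=; apply/andP; split; lra.
have g0 k : 0 <= g k by rewrite mulr_ge0 ?(ltW K0)// le_max lexx.
apply: (@le_trans _ _ (\sum_(0 <= k < L * N) (g k)%:E * mu `[b k, b k.+1[%classic)%E); last first.
  apply: cell_sum_le_integral => //.
  - apply/measurable_EFinP; apply: measurable_funM => //.
    by apply: measurable_funX; exact: measurable_CD_kernel.
  - by move=> y _; rewrite lee_fin divr_ge0 ?sqr_ge0// ltW.
  - exact: bA.
  - move=> k kLN y /(cellin k kLN)[_ hy]; rewrite lee_fin.
    have := cell k _ (kM k kLN) hy.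
    by rewrite mulfK ?gt_eqF// (_ : x0 + (y - x0) = y) //; ring.
have mass k : (k < L * N)%N -> h - tau <= K * fine (mu `[b k, b k.+1[%classic).
  move=> kLN.
  have bb : b k <= b k.+1 by exact: bmono.
  (* The radius is doubled because the first cell contains its left end [x0 - M / c], which the open
     window of radius [M / c] misses. *)
  have Mr : M / c < 2 * M / c by rewrite ltr_pM2r ?invr_gt0//; lra.
  have : ((w x0 * (b k.+1 - b k))%:E <= mu `[b k, b k.+1[%classic +
      (2 * (2 * M / c) * (w x0 * tau / (4 * M)))%:E)%E.
    apply: (le_trans (cell_measure_ge hdec (ltW w0) bb (bA _ Mr k kLN))).
    exact: leeD2l (hr0 _ hr).
  have fm : mu `[b k, b k.+1[%classic \is a fin_num by exact: fin_num_measure.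
  have -> : b k.+1 - b k = h / c.
    by rewrite /b /h -natr1; field; rewrite !gt_eqF.
  case: (mu `[b k, b k.+1[%classic) fm => [f| |]//= _.
  rewrite -EFinD lee_fin.
  have -> : 2 * (2 * M / c) * (w x0 * tau / (4 * M)) = w x0 * tau / c.
    by field; rewrite !gt_eqF.
  rewrite -(ler_pM2l K0).
  have -> : K * (w x0 * (h / c)) = h by rewrite cE; field; rewrite !gt_eqF.
  have -> : K * (f + w x0 * tau / c) = K * f + tau.
    by rewrite cE; field; rewrite !gt_eqF.
  lra.
have htau : 0 <= h - tau by rewrite /tau; nra.
(* The lower bound on the cell mass is multiplied by the truncated value, which is nonnegative;
   dropping the truncation afterwards only decreases the bound. *)
have step k : (k < L * N)%N ->
    (((h - tau) * (q k ^+ 2 / (1 + 2 * eta) - 2 * eta))%:E <=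
     (g k)%:E * mu `[b k, b k.+1[%classic)%E.
  move=> kLN; rewrite -[mu _]fineK ?fin_num_measure// -EFinM lee_fin.
  have := mass k kLN; move: (fine _) => f hf.
  rewrite /g; set X := q k ^+ 2 / _ - _.
  apply: (@le_trans _ _ ((h - tau) * Num.max 0 X)).
    by rewrite ler_wpM2l// le_max lexx orbT.
  by rewrite mulrAC ler_wpM2r// le_max lexx.
apply: (@le_trans _ _
  (\sum_(0 <= k < L * N) ((h - tau) * (q k ^+ 2 / (1 + 2 * eta) - 2 * eta))%:E)%E); last first.
  rewrite big_seq [leRHS]big_seq; apply: lee_sum => k.
  by rewrite mem_index_iota => /andP[_]; exact: step.
rewrite sumEFin lee_fin -mulr_sumr sumrB -mulr_suml.
rewrite [X in _ * (_ - X)](_ : _ = 2 * eta * (2 * M * N%:R)); last first.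
  by rewrite sumr_const_nat subn0 -[LHS]mulr_natr natrM LM.
have := riemann_sum_sine_kernel R m N0; rewrite -/L -/M -natrX -/L LM.
rewrite -/(q _); set S := \sum_(0 <= k < L * N) q k ^+ 2 => hS.
have hN : h * N%:R = 1 by rewrite mulVf// gt_eqF.
have etaE : eta * (1 + 2 * M) = e / 8 by rewrite /eta; field; rewrite gt_eqF//; lra.
have SN : N%:R * (1 - e / 4 - 2 * eta) <= S / (1 + 2 * eta).
  rewrite ler_pdivlMr; last by lra.
  apply: le_trans hS; rewrite -mulrA ler_pM2l//; nra.
have : (h - tau) * (N%:R * (1 - e / 2)) <=
    (h - tau) * (S / (1 + 2 * eta) - 2 * eta * (2 * M * N%:R)).
  rewrite ler_wpM2l//; apply: le_trans (lerB SN (lexx _)).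
  rewrite [leRHS](_ : _ = N%:R * (1 - e / 4 - 2 * (eta * (1 + 2 * M)))); last by ring.
  by rewrite etaE ler_pM2l//; lra.
(* One factor [1 - e / 2] comes from the cell masses, the other from the Riemann sum; their product
   is at least [1 - e]. *)
rewrite (_ : (h - tau) * _ = (h * N%:R) * (1 - e / 2) ^+ 2); last by rewrite /tau; ring.
rewrite hN; nra.
Unshelve. all: by end_near. Qed.

(** * From concentration of mass to the Nevai condition *)

Lemma compact_support_bounded (R : realType) (f : R -> R) :
  continuous f -> compact (closure [set y | f y != 0]) ->
  exists2 B, 0 < B & forall y, `|f y| <= B.
Proof.
move=> cf ck.
have /compact_bounded[M [_ hM]] := continuous_compact (continuous_subspaceT cf) ck.
have M1 : M < `|M| + 1 by rewrite (le_lt_trans (ler_norm M))// ltrDl.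
exists (`|M| + 1); first by rewrite ltr_wpDl.
move=> y; have [->|fy] := eqVneq (f y) 0; first by rewrite normr0 addr_ge0.
by apply: (hM _ M1); exists y => //; exact: subset_closure.
Qed.

Lemma le_abse_integral_split (R : realType)
    (mu : {measure set (measurableTypeR R) -> \bar R})
    (A : set (measurableTypeR R)) (F u : R -> R) (a c : R) :
  measurable A ->
  measurable_fun setT (F : measurableTypeR R -> measurableTypeR R) ->
  measurable_fun setT (u : measurableTypeR R -> measurableTypeR R) ->
  (forall y, 0 <= F y) -> 0 <= a -> 0 <= c ->
  (forall y, A y -> `|u y| <= a) -> (forall y, `|u y| <= c) ->
  (`| \int[mu]_y (u y * F y)%:E | <=
   a%:E * \int[mu]_(y in A) (F y)%:E + c%:E * \int[mu]_(y in ~` A) (F y)%:E)%E.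
Proof.
move=> mA mF mu_u F0 a0 c0 ha hc.
have mFE : measurable_fun setT (fun y : measurableTypeR R => (F y)%:E).
  exact/measurable_EFinP.
have muF : measurable_fun setT (fun y : measurableTypeR R => (u y * F y)%:E).
  by apply/measurable_EFinP; exact: measurable_funM.
have muFa : measurable_fun setT (fun y : measurableTypeR R => `|(u y * F y)%:E|%E).
  exact: measurableT_comp.
have bound (D : set (measurableTypeR R)) t : measurable D -> 0 <= t ->
    (forall y, D y -> `|u y| <= t) ->
    (\int[mu]_(y in D) `|(u y * F y)%:E| <= t%:E * \int[mu]_(y in D) (F y)%:E)%E.
  move=> mD t0 ht; rewrite -ge0_integralZl_EFin//; last 2 first.
  - by move=> y _; rewrite lee_fin.
  - exact: measurable_funTS.
  apply: ge0_le_integral => //.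
  - exact: measurable_funTS.
  - by apply: measurable_funTS; apply: measurable_funeM.
  - by move=> y Dy; rewrite -EFinM lee_fin normrM (ger0_norm (F0 y)) ler_wpM2r// ht.
apply: (le_trans (le_abse_integral mu measurableT muF)).
rewrite -(setUv A) ge0_integral_setU//.
- by apply: leeD; apply: bound => //; exact: measurableC.
- exact: measurableC.
- exact: measurable_funTS.
- exact/disj_setPCl.
Qed.

Theorem theorem5p5 (R : realType)
    (mu : probability (measurableTypeR R) R)
    (w : R -> R) (mu_sing : {measure set (measurableTypeR R) -> \bar R})
    (p : nat -> {poly R}) (xstar : R)
    (hmom : finite_moments mu)
    (hinf : infinite_set (supp mu))
    (hdec : lebesgue_decomposition mu w mu_sing)
    (hp : orthonormal_polynomials mu p)
    (hx : supp mu xstar)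
    (hleb : lebesgue_point w mu_sing xstar)
    (huniv : bulk_universality w p xstar) :
  nevai_condition mu p xstar.
Proof.
move=> f cf /(compact_support_bounded cf)[B B0 hB].
apply/fine_cvgP.
set I := fun n => (\int[mu]_y _)%E.
suff H e : 0 < e -> \forall n \near \oo, (`|I n| <= e%:E)%E.
  split.
    (* The bound with [e = 1] also shows that the extended-real integrals are eventually finite. *)
    have := H 1 ltr01; apply: filterS => n hn.
    by rewrite -abse_fin_num ge0_fin_numE// (le_lt_trans hn)// ltry.
  apply/cvgrPdist_le => e /H; apply: filterS => n /=.
  rewrite sub0r normrN; case: (I n) => [r| |]//=.
move=> e0.
have e20 : 0 < e / 2 by rewrite divr_gt0.
have [delta delta0 hdelta] : exists2 delta, 0 < delta &
    forall y, `|y - xstar| < delta -> `|f y - f xstar| <= e / 2.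
  have /cvgrPdist_le/(_ _ e20)[d /= d0 hd] := cf xstar.
  exists d => // y yd; rewrite distrC; apply: hd.
  by rewrite /ball/= distrC.
(* Away from [xstar] the integrand's factor is at most [2 * B], so a remaining mass [t] contributes
   [e / 2]. *)
pose t := e / 2 / (2 * B).
have t0 : 0 < t by rewrite divr_gt0// mulr_gt0.
have [w0 _ _] := hleb; have [sp _ _] := hp.
near=> n.
have K0 : 0 < CD_kernel p n xstar xstar.
  by near: n; exact: (CD_kernel_diag_cvgy w0 (sp 0%N) (sp 1%N) huniv).
have mass : ((1 - t)%:E <=
    \int[mu]_(y in `]xstar - delta, xstar + delta[%classic%R)
      (CD_kernel p n xstar y ^+ 2 / CD_kernel p n xstar xstar)%:E)%E.
  by near: n; exact: (CD_kernel_mass_near hdec hp hleb huniv).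
set A := (`]xstar - delta, xstar + delta[%classic)%R in mass.
pose F y := CD_kernel p n xstar y ^+ 2 / CD_kernel p n xstar xstar.
have F0 y : 0 <= F y by rewrite divr_ge0 ?sqr_ge0// ltW.
have mF : measurable_fun setT (F : measurableTypeR R -> measurableTypeR R).
  by apply: measurable_funM => //; apply: measurable_funX; exact: measurable_CD_kernel.
have mFE : measurable_fun setT (fun y : measurableTypeR R => (F y)%:E).
  exact/measurable_EFinP.
have mA : measurable (A : set (measurableTypeR R)) by exact: measurable_itv.
have total : (\int[mu]_(y in A) (F y)%:E + \int[mu]_(y in ~` A) (F y)%:E = 1)%E.
  rewrite -ge0_integral_setU//.
  - rewrite setUv.
    under eq_integral do rewrite /F mulrC EFinM.
    rewrite ge0_integralZl_EFin//.
    + by rewrite integral_sqr_CD_kernel// -EFinM mulVf// gt_eqF.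
    + by move=> y _; rewrite lee_fin sqr_ge0.
    + by apply/measurable_EFinP; apply: measurable_funX; exact: measurable_CD_kernel.
    + by rewrite invr_ge0 ltW.
  - exact: measurableC.
  - by rewrite setUv.
  - by move=> y _; rewrite lee_fin.
  - exact/disj_setPCl.
have mg : measurable_fun setT ((fun y => f y - f xstar) : measurableTypeR R -> measurableTypeR R).
  by apply: measurable_funB => //; exact: continuous_measurable_fun.
have hA y : A y -> `|f y - f xstar| <= e / 2.
  rewrite /A /= in_itv/= => /andP[h1 h2]; apply: hdelta.
  by rewrite ltr_norml; apply/andP; split; lra.
have hT y : `|f y - f xstar| <= 2 * B.
  apply: le_trans (ler_normB _ _) _.
  by rewrite mulrDl mul1r lerD.
apply: (le_trans (le_abse_integral_split mu mA mF mg F0 (ltW e20) _ hA hT)).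
  by rewrite mulr_ge0// ltW.
have I1 : (0 <= \int[mu]_(y in A) (F y)%:E)%E.
  by apply: integral_ge0 => y _; rewrite lee_fin.
have I2 : (0 <= \int[mu]_(y in ~` A) (F y)%:E)%E.
  by apply: integral_ge0 => y _; rewrite lee_fin.
(* Two nonnegative extended reals with sum 1 are finite, which leaves real arithmetic. *)
move: mass total I1 I2; rewrite -/(F _).
case: (\int[mu]_(y in A) _)%E => [a| |]//; case: (\int[mu]_(y in ~` A) _)%E => [b| |]//.
rewrite -!EFinM -!EFinD !lee_fin => h1 [h2] h3 h4.
rewrite [leRHS](_ : e = e / 2 + 2 * B * t); last by rewrite /t; field; rewrite gt_eqF.
have a1 : a <= 1 by lra.
have bt : b <= t by lra.
apply: lerD; first by rewrite ler_piMr// ltW.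
by rewrite ler_wpM2l// mulr_ge0// ltW.
Unshelve. all: by end_near. Qed.
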